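(* Let $G$ be a finite abelian group of order $r$ and of exponent greater than $2$, let $\iota\colon G\to G$, $g\mapsto g^{-1}$ be the inversion on $G$, and let $\delta\in(0,1/2)$. Put \[ h_\delta(r)= 2^{-\frac{r}{24}+(r^{2\delta}+r^\delta+6)(\log_2r)^2+5\log_2r+4}+2^{-\frac{2}{25}r^\delta+3\log_2r+1}. \] Then the proportion, among all inverse-closed subsets $S\subseteq G$, of those with \[ \mathrm{Aut}(D(\mathrm{Cay}(G,S)))=(R(G)\rtimes\langle\iota\rangle)\times C_2 \] is at least $1-h_\delta(r)$. In particular, the proportion of inverse-closed subsets $S\subseteq G$ such that $\mathrm{Cay}(G,S)$ is stable is at least $1-h_\delta(r)$.
   Context: For an inverse-closed subset $S$ of a group $G$ (the identity is allowed to lie in $S$), the Cayley graph $\mathrm{Cay}(G,S)$ has vertex set $G$, with $x$ and $y$ adjacent iff $yx^{-1}\in S$ (so there is a loop at every vertex if $1\in S$). For a graph $\Gamma$ with vertex set $V$, the standard double cover $D(\Gamma)=\Gamma\times K_2$ has vertex set $V\times\{0,1\}$, with $(u,x)$ adjacent to $(v,y)$ iff $u$ and $v$ are adjacent in $\Gamma$ and $x\neq y$. Always $\mathrm{Aut}(D(\Gamma))\ge \mathrm{Aut}(\Gamma)\times\mathrm{Aut}(K_2)$, where $\mathrm{Aut}(\Gamma)$ acts on the first coordinate and $\mathrm{Aut}(K_2)\cong C_2$ is generated by the swap $(v,i)\mapsto(v,1-i)$; $\Gamma$ is called stable if equality holds. For $g\in G$, $R(g)$ is the permutation $x\mapsto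 xg$ of $G$, and $R(G)=\{R(g)\mid g\in G\}$. A permutation $\alpha$ of $G$ is regarded also as the permutation $(g,i)\mapsto(g^\alpha,i)$ of $G\times\{0,1\}$; thus $(R(G)\rtimes\langle\iota\rangle)\times C_2$ denotes the subgroup of $\mathrm{Sym}(G\times\{0,1\})$ generated by all $R(g)$, $\iota$ (acting on first coordinates) and the swap $(g,i)\mapsto(g,1-i)$. *)

(* Defs.v *)
From mathcomp Require Import all_boot all_order all_fingroup.
From mathcomp Require Import all_algebra abelian reals exp.

Set Implicit Arguments.
Unset Strict Implicit.
Unset Printing Implicit Defensive.

Import GroupScope GRing.Theory Num.Theory.

(* Graphs are adjacency relations on a finite type, loops allowed. *)

Section Graphs.

Variable V : finType.
Implicit Type E : rel V.

Definition graph_aut E : {set {perm V}} :=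
  [set a : {perm V} | [forall x, forall y, E (a x) (a y) == E x y]].

Lemma graph_aut_group_set E : group_set (graph_aut E).
Proof.
apply/group_setP; split=> [|a b].
  by rewrite inE; apply/'forall_forallP=> x y; rewrite !perm1.
rewrite !inE => /'forall_'forall_eqP aE /'forall_'forall_eqP bE.
by apply/'forall_'forall_eqP=> x y; rewrite !permM bE aE.
Qed.

Canonical graph_aut_group E : {group {perm V}} := Group (graph_aut_group_set E).

End Graphs.

Definition direct_product (V W : finType) (E : rel V) (F : rel W) :
  rel (V * W) := fun p q => E p.1 q.1 && F p.2 q.2.

Definition K2 : rel bool := fun x y => x != y.

Definition double_cover (V : finType) (E : rel V) : rel (V * bool) :=
  direct_product E K2.

Section PairPerm.

Variables V W : finType.

Lemma pair_perm_inj (a : {perm V}) (b : {perm W}) :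
  injective (fun p : V * W => (a p.1, b p.2)).
Proof. by move=> [x y] [x' y'] [/perm_inj-> /perm_inj->]. Qed.

Definition pair_perm (a : {perm V}) (b : {perm W}) : {perm V * W} :=
  perm (@pair_perm_inj a b).

End PairPerm.

Definition stable_graph (V : finType) (E : rel V) : bool :=
  graph_aut (double_cover E) ==
    [set pair_perm a b | a in graph_aut E, b in graph_aut K2].

Section Cayley.

Variable gT : finGroupType.
Implicit Type S : {set gT}.

Definition inverse_closed S : bool := [forall x in S, x^-1 \in S].

Definition Cay S : rel gT := fun x y => y * x^-1 \in S.

Definition right_translation (g : gT) : {perm gT} := perm (@mulIg gT g).

Definition inversion : {perm gT} := perm (@invg_inj gT).

Definition swap : {perm bool} := perm negb_inj.

(* The group (R(G) ><| <iota>) x C_2 acting on G * {0, 1}. *)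
Definition expected_aut : {set {perm gT * bool}} :=
  << [set pair_perm (right_translation g) 1 | g : gT]
     :|: [set pair_perm inversion 1; pair_perm 1 swap] >>.

End Cayley.

Local Open Scope ring_scope.

(* Proportion, among all inverse-closed subsets of G, of those satisfying P;
   the denominator is nonzero since the empty set is inverse-closed. *)
Definition proportion (R : realType) (gT : finGroupType)
    (P : pred {set gT}) : R :=
  #|[set S : {set gT} | inverse_closed S && P S]|%:R
    / #|[set S : {set gT} | inverse_closed S]|%:R.

Definition log2 (R : realType) (x : R) : R := ln x / ln 2.

Definition h (R : realType) (delta : R) (r : nat) : R :=
  2 `^ (- (r%:R / 24)
        + (r%:R `^ (2 * delta) + r%:R `^ delta + 6) * log2 r%:R ^+ 2
        + 5 * log2 r%:R + 4)
  + 2 `^ (- (2 / 25 * r%:R `^ delta) + 3 * log2 r%:R + 1).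

(* Main.v *)
Require Import Defs.
From mathcomp Require Import all_boot all_order all_fingroup.
From mathcomp Require Import all_algebra abelian reals exp.
From mathcomp Require Import zify lra.

Set Implicit Arguments.
Unset Strict Implicit.
Unset Printing Implicit Defensive.

Import Order.TTheory GRing.Theory Num.Theory.

(**
Let phi be an automorphism of the double cover of Cay(G, S).  For vertices p, q
on opposite sides it forces the bit [q p^-1 \in S] to agree with the bit of
[phi(q) phi(p)^-1] (or to be 0 if the images are on the same side).  This
restricts S unless phi(q) phi(p)^-1 = (q p^-1)^{+-1}; call (p, q) broken
otherwise.  If the broken pairs among a partial map involve m elements q p^-1,
then at most a fraction 2^(-m/6) of the inverse-closed sets S are compatible
with that map, so a union bound over partial maps on O(n) points suffices as
soon as m >= 12 n^2, with n larger than a constant times log r.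

Call p heavy if at least r/6 pairs (p, q) are broken.  If some side contains
12n heavy vertices, a greedy choice of 12n further vertices yields 12 n^2
elements.  Otherwise a light vertex exists, and after composing phi with a
translation and the swap it is fixed.  Comparing two light vertices shows that
phi agrees with the identity or with one inversion on most of the other side,
because in a group of exponent greater than 2 the equation x^2 = c has at most
r/2 solutions.  After composing with this inversion every moved vertex is
heavy, so at most 24n vertices move: listing them determines phi, and a single
moved heavy vertex already gives r/6 elements.

When h_delta(r) < 1, both of its exponents are negative, and n just above
r^delta satisfies all the requirements.
*)

(** * Counting inverse-closed sets subject to independent constraints *)

Section Counting.
Local Open Scope group_scope.
Variable gT : finGroupType.
Implicit Types (S U D : {set gT}) (f : gT -> option gT).

Lemma inverse_closedV S x : inverse_closed S -> (x^-1 \in S) = (x \in S).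
Proof.
move=> /forall_inP SV; apply/idP/idP => xS; last exact: SV.
by rewrite -[x]invgK SV.
Qed.

Definition closed_sets : {set {set gT}} := [set S | inverse_closed S].

(** The first clause lets an inverse-closed set be changed freely at each element of [D]; the second
    keeps the values of [f] unaffected by such changes. *)
Definition independent f D :=
  [/\ {in D &, forall d d', d' = d^-1 -> d' = d}
    & {in D &, forall d d', f d != Some d' /\ f d != Some d'^-1}].

Definition meets_constraints f D S :=
  {in D, forall d, (d \in S) = oapp (fun w => w \in S) false (f d)}.

(** Toggling a solution [S] on [U] and its inverses, for [U] inside [D], gives another
    inverse-closed set. The pair [(S, U)] can be recovered from it: the constraints determine [S] on
    [D] from places that were not toggled, and [U] is then the difference on [D]. *)
Lemma independent_count f D (Sol : {set {set gT}}) :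
    independent f D ->
    {in Sol, forall S, inverse_closed S /\ meets_constraints f D S} ->
  (#|Sol| * 2 ^ #|D| <= #|closed_sets|)%N.
Proof.
move=> [indV indf] solP.
pose flip (SU : {set gT} * {set gT}) : {set gT} :=
  [set x | (x \in SU.1) (+) ((x \in SU.2) || (x^-1 \in SU.2))].
rewrite -card_powerset -cardsX -(card_in_imset (f := flip)).
  apply: subset_leq_card; apply/subsetP => _ /imsetP[[S U] /setXP[/solP[SI _] _] ->].
  rewrite inE; apply/forall_inP => x; rewrite !inE /= (inverse_closedV x SI) invgK.
  by rewrite orbC.
have off S U w : U \subset D -> (forall d, d \in D -> w != d /\ w != d^-1) ->
    (w \in flip (S, U)) = (w \in S).
  move=> /subsetP UD wD; rewrite inE /=.
  case: (boolP (w \in U)) => [/UD/wD[/eqP//]|_].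
  case: (boolP (w^-1 \in U)) => [/UD/wD[_]|_]; first by rewrite invgK eqxx.
  by rewrite addbF.
have onD S U d : inverse_closed S -> meets_constraints f D S -> U \subset D ->
    d \in D -> (d \in S) = oapp (fun w => w \in flip (S, U)) false (f d).
  move=> SI SC UD dD; rewrite SC //; case fd: (f d) => [w|] //=.
  rewrite off // => d' d'D; have [] := indf _ _ dD d'D.
  by rewrite fd => h1 h2; split; [apply: contraNneq h1 | apply: contraNneq h2] => ->.
move=> [S U] [S' U'] /setXP[/= /solP[SI SC]]; rewrite inE => UD.
move=> /setXP[/= /solP[SI' SC']]; rewrite inE => UD' eqf.
have eqD d : d \in D -> (d \in S) = (d \in S').
  by move=> dD; rewrite (onD S U) // (onD S' U') // eqf.
have eqS : S = S'.
  apply/setP => x; case: (boolP (x \in D)) => [/eqD//|xD].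
  case: (boolP (x^-1 \in D)) => [/eqD|xVD]; first by rewrite !inverse_closedV.
  rewrite -(off S U) // ?eqf ?off // => d dD; split.
  - by apply: contraNneq xD => ->.
  - by apply: contraNneq xVD => ->; rewrite invgK.
  - by apply: contraNneq xD => ->.
  - by apply: contraNneq xVD => ->; rewrite invgK.
congr pair => //; subst S'.
(* An inverse of [d] lying in [D] equals [d], so toggling [W] and its inverses acts on [D] as
   toggling [W] alone. *)
have recU (W : {set gT}) d : W \subset D -> d \in D ->
    (d \in flip (S, W)) = (d \in S) (+) (d \in W).
  move=> /subsetP WD dD; rewrite inE /=; congr (_ (+) _).
  case: (boolP (d \in W)) => //= dW; apply/negbTE/negP => dVW.
  by move: dW; rewrite -(indV d d^-1) ?dVW // WD.
apply/setP => x; case: (boolP (x \in D)) => [xD|xD].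
  apply: (can_inj (addKb (x \in S))).
  by rewrite -!recU // eqf.
have nW (W : {set gT}) : W \subset D -> (x \in W) = false.
  by move=> /subsetP WD; apply: contraNF xD => /WD.
by rewrite !nW.
Qed.

(* Some [z] is hit at most twice by [f] up to inversion; choosing it discards at
   most six elements: [z], [f z], their inverses and the two preimages. *)
Lemma independent_exists f D e :
    (6 * e <= #|D|)%N -> {in D, forall d, f d != Some d /\ f d != Some d^-1} ->
  exists D', [/\ D' \subset D, (e <= #|D'|)%N & independent f D'].
Proof.
elim: e D => [|e IHe] D De fD.
  exists set0; split; rewrite ?sub0set //.
  by split=> d d'; rewrite inE.
pose pre z := [set d in D | (f d == Some z) || (f d == Some z^-1)].
(* Double counting: each [d] lies in [pre z] for at most two [z], so the average size of [pre z] is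
   at most two. *)
have [z zD prez] : exists2 z, z \in D & (#|pre z| <= 2)%N.
  case: (pickP (fun z => (z \in D) && (#|pre z| <= 2)%N)) => [z /andP[zD ?]|big0].
    by exists z.
  have big z : z \in D -> (2 < #|pre z|)%N.
    by move=> zD; have := big0 z; rewrite zD /= leqNgt => /negbFE.
  exfalso; have : (\sum_(z in D) 3 <= \sum_(z in D) #|pre z|)%N.
    by apply: leq_sum => z /big; rewrite ltnNge.
  have -> : (\sum_(z in D) #|pre z| =
      \sum_(d in D) #|[set z in D | (f d == Some z) || (f d == Some z^-1)]|)%N.
    rewrite (eq_bigr (fun z => \sum_(d in D) ((f d == Some z) || (f d == Some z^-1)))%N).
      rewrite exchange_big; apply: eq_bigr => d _.
      rewrite -sum1_card big_mkcond [RHS]big_mkcond; apply: eq_bigr => z _.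
      by rewrite !inE; case: (_ \in D); case: (_ || _).
    move=> z _; rewrite -sum1_card big_mkcond [RHS]big_mkcond.
    by apply: eq_bigr => d _; rewrite !inE; case: (_ \in D); case: (_ || _).
  move=> h; have : (\sum_(z in D) 3 <= \sum_(d in D) 2)%N.
    apply: leq_trans h _; apply: leq_sum => d dD.
    case fd: (f d) => [w|].
      apply: (@leq_trans #|[set w; w^-1]|); last by rewrite cards2; case: eqP.
      apply: subset_leq_card; apply/subsetP => z; rewrite !inE => /andP[_].
      by move=> /orP[/eqP[->]|/eqP[->]]; rewrite ?invgK eqxx ?orbT.
    by rewrite eq_card0 // => z; rewrite !inE andbF.
  rewrite !sum_nat_const leq_pmul2l //; apply: leq_trans De; lia.
pose bad := [set z; z^-1] :|: (if f z is Some w then [set w; w^-1] else set0) :|: pre z.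
have card2 (x y : gT) : (#|[set x; y]| <= 2)%N by rewrite cards2; case: eqP.
have badc : (#|bad| <= 6)%N.
  set W := if f z is Some w then [set w; w^-1] else set0.
  have Wc : (#|W| <= 2)%N by rewrite /W; case: (f z) => [w|] //; rewrite cards0.
  rewrite /bad -/W; have := leq_of_leqif (leq_card_setU ([set z; z^-1] :|: W) (pre z)).
  have := leq_of_leqif (leq_card_setU [set z; z^-1] W); have := card2 z z^-1.
  by move: prez Wc; do 5 move: #|_|; lia.
have [||D' [D'D eD' [iV iF]]] := IHe (D :\: bad).
- have := subset_leq_card (subsetIr D bad); have := cardsID bad D; lia.
- by move=> d /setDP[dD _]; apply: fD.
have D'P d : d \in D' -> d \in D /\ d \notin bad.
  by move=> /(subsetP D'D) /setDP[].
exists (z |: D'); split.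
- by rewrite subUset sub1set zD; apply: subset_trans D'D (subsetDl _ _).
- rewrite cardsU1; case: (boolP (z \in D')) => [/D'P[_]|_]; last by rewrite add1n.
  by rewrite !inE eqxx.
- split=> d d' /setU1P[->|dD'] /setU1P[->|d'D'] //.
  + by move=> eq; have [_] := D'P _ d'D'; rewrite eq !inE eqxx orbT.
  + by move=> eq; have [_] := D'P _ dD'; rewrite !inE -(invgK d) -eq eqxx orbT.
  + exact: iV.
  + exact: fD.
  + have [_] := D'P _ d'D'; case fz: (f z) => [w|] //.
    rewrite /bad fz !inE !negb_or => /andP[/andP[_ /andP[dw dwV]] _].
    split; first by apply: contraNneq dw => -[->].
    by apply: contraNneq dwV => -[->]; rewrite invgK.
  + by have [dD] := D'P _ dD'; rewrite !inE dD /= !negb_or => /andP[_ /andP[]].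
  + exact: iF.
Qed.
End Counting.

(** * Constraints imposed by partial maps of the double cover *)

Section Constraints.
Local Open Scope group_scope.
Variable gT : finGroupType.
Notation V := (gT * bool)%type.
Implicit Types (S : {set gT}) (p q : V) (a b : V * V) (Q : {set V * V}).

(* [p] and [q] are adjacent in the double cover iff they lie on opposite sides
   and [gap p q \in S]. *)
Definition gap p q : gT := q.1 * p.1^-1.

(* A pair of vertices [a = (p, p')] records that an automorphism maps [p] to
   [p'].  The relation says that [a] and [b] together restrict [S]. *)
Definition forced a b :=
  (a.1.2 != b.1.2) &&
  ~~ [&& a.2.2 != b.2.2 & gap a.2 b.2 \in [set gap a.1 b.1; (gap a.1 b.1)^-1]].

Definition compatible Q : {set {set gT}} :=
  [set S in closed_sets gT | [forall a in Q, forall b in Q,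
     double_cover (Cay S) a.2 b.2 == double_cover (Cay S) a.1 b.1]].

Definition constrained Q : {set gT} :=
  [set gap a.1 b.1 | a in Q, b in Q & forced a b].

Lemma double_coverE S p q :
  double_cover (Cay S) p q = (gap p q \in S) && (p.2 != q.2).
Proof. by []. Qed.

Lemma constrainedS Q Q' : Q \subset Q' -> constrained Q \subset constrained Q'.
Proof.
move=> /subsetP QQ'; apply/subsetP => z /imset2P[a b aQ]; rewrite inE => /andP[bQ fab] ->.
by apply/imset2P; exists a b; rewrite ?inE ?fab ?QQ'.
Qed.

(** A chosen witness pair turns each constrained element into one constraint, with [None] when the
    images share a side. By [forced] no element is sent to itself or its inverse, so an independent
    sixth of the constraints can be extracted. *)
Lemma compatible_count Q e :
  (6 * e <= #|constrained Q|)%N -> (#|compatible Q| * 2 ^ e <= #|closed_sets gT|)%N.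
Proof.
move=> Qe.
pose wit z := [pick ab : (V * V) * (V * V) |
   [&& ab.1 \in Q, ab.2 \in Q, forced ab.1 ab.2 & z == gap ab.1.1 ab.2.1]].
pose f z := if wit z is Some ab then
    if ab.1.2.2 != ab.2.2.2 then Some (gap ab.1.2 ab.2.2) else None else None.
have fP z : z \in constrained Q -> exists a b,
    [/\ a \in Q, b \in Q, forced a b, z = gap a.1 b.1 &
      f z = if a.2.2 != b.2.2 then Some (gap a.2 b.2) else None].
  case/imset2P => a b aQ; rewrite inE => /andP[bQ fab] zE.
  rewrite /f /wit; case: pickP => [[a' b'] /and4P[/= ? ? ? /eqP ?]|/(_ (a, b))].
    by exists a', b'.
  by rewrite /= aQ bQ fab zE eqxx.
have [|D [/subsetP DQ De indD]] := independent_exists (f := f) Qe.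
  move=> z /fP[a [b [aQ bQ /andP[_ fab] zE ->]]]; case: ifP fab => // _ /=.
  by rewrite -zE !inE negb_or => /andP[].
apply: leq_trans (independent_count (Sol := compatible Q) indD _).
  by rewrite leq_mul2l leq_pexp2l ?orbT.
move=> S; rewrite !inE => /andP[SI /forall_inP SC]; split=> // z /DQ/fP.
move=> [a [b [aQ bQ /andP[oab fab] -> ->]]].
have /eqP := forall_inP (SC a aQ) b bQ.
rewrite !double_coverE oab andbT => <-.
by case: (a.2.2 != b.2.2); rewrite ?andbT ?andbF.
Qed.

Implicit Types (phi : {perm V}).

Definition broken phi p q := forced (p, phi p) (q, phi q).

Definition heavy phi p := (#|gT| <= 6 * #|[set q | broken phi p q]|)%N.

Definition perm_graph phi (A : {set V}) := [set (p, phi p) | p in A].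

Lemma broken_side phi p q : broken phi p q -> p.2 != q.2.
Proof. by case/andP. Qed.

Lemma gap_inj p : {in [pred q | p.2 != q.2] &, injective (gap p)}.
Proof.
move=> [q s] [q' s'] /=; rewrite !inE /gap /= => h h' /mulIg ->; congr pair.
by move: h h'; case: s s' p.2 => [] [] [].
Qed.

Lemma gap_injl q : {in [pred p | p.2 != q.2] &, injective (gap^~ q)}.
Proof.
move=> [p s] [p' s'] /=; rewrite !inE /gap /= => h h' /mulgI/invg_inj ->; congr pair.
by move: h h'; case: s s' q.2 => [] [] [].
Qed.

Lemma constrained_graphP phi (A : {set V}) p q :
  p \in A -> q \in A -> broken phi p q -> gap p q \in constrained (perm_graph phi A).
Proof.
move=> pA qA br; apply/imset2P; exists (p, phi p) (q, phi q) => //.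
  exact: imset_f.
by rewrite inE; apply/andP; split=> //; apply: imset_f.
Qed.

(** Averaging over the opposite side: each heavy [p] in [B] has at least r/6 - |Z| broken partners
    with gap outside [Z], where r is the group order. *)
Lemma greedy_step phi (B : {set V}) s n (Z : {set gT}) :
    {in B, forall p, p.2 = s /\ heavy phi p} -> #|B| = (12 * n)%N ->
    (144 * n ^ 2 <= #|gT|)%N -> (#|Z| < 12 * n ^ 2)%N ->
  exists q, (n <= #|[set p in B | broken phi p q && (gap p q \notin Z)]|)%N.
Proof.
move=> BP Bn nr Zn.
case: (pickP (fun q => n <= #|[set p in B | broken phi p q && (gap p q \notin Z)]|)%N).
  by move=> q qn; exists q.
move=> small; exfalso.
have r_gt0 : (0 < #|gT|)%N by apply/card_gt0P; exists 1.
pose good p q := broken phi p q && (gap p q \notin Z).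
have dbl : (\sum_(p in B) #|[set q | good p q]| =
    \sum_(g : gT) #|[set p in B | good p (g, ~~ s)]|)%N.
  rewrite (eq_bigr (fun p => \sum_(g : gT) good p (g, ~~ s))%N).
    rewrite exchange_big; apply: eq_bigr => g _ /=.
    rewrite -sum1_card big_mkcond [RHS]big_mkcond; apply: eq_bigr => p _.
    by rewrite !inE; case: (p \in B); case: (good _ _).
  move=> p /BP[ps _]; transitivity #|[set g | good p (g, ~~ s)]|; last first.
    by rewrite -sum1_card big_mkcond; apply: eq_bigr => g _; rewrite inE.
  rewrite -(card_imset (f := fun g : gT => (g, ~~ s))); last by move=> g g' [].
  apply: eq_card => -[g t]; rewrite inE; apply/idP/imsetP => [gd|[g']].
    have tE : t = ~~ s.
      by have /andP[/broken_side] := gd; rewrite ps /=; case: (s); case: (t).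
    by exists g; rewrite ?inE -?tE.
  by rewrite inE => gd [-> ->].
have up : (\sum_(g : gT) #|[set p in B | good p (g, ~~ s)]| <= #|gT| * n.-1)%N.
  rewrite -sum_nat_const; apply: leq_sum => g _.
  by have /negbT := small (g, ~~ s); rewrite -ltnNge; case: (n).
have lo : (\sum_(p in B) (#|gT| - 6 * #|Z|) <= 6 * \sum_(p in B) #|[set q | good p q]|)%N.
  rewrite big_distrr /=; apply: leq_sum => p /BP[_]; rewrite /heavy => hv.
  have : (#|[set q | broken phi p q]| <= #|[set q | good p q]| + #|Z|)%N.
    rewrite -(cardsID [set q | gap p q \notin Z]); apply: leq_add.
      by apply: subset_leq_card; apply/subsetP => q; rewrite !inE.
    rewrite -(card_in_imset (f := gap p)).
      apply: subset_leq_card; apply/subsetP => _ /imsetP[q qP ->].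
      by move: qP; rewrite !inE negbK => /andP[].
    move=> q q' /setDP[+ _] /setDP[+ _]; rewrite !inE.
    by move=> /broken_side ? /broken_side ?; apply: gap_inj.
  by move: hv; do 4 move: #|_|; lia.
move: lo; rewrite dbl sum_nat_const Bn => lo.
(* Since 6|Z| < 72n^2 <= r/2, the left side is at least 6nr, while the right side is 6(n-1)r. *)
have : (12 * n * (#|gT| - 6 * #|Z|) <= 6 * (#|gT| * n.-1))%N by lia.
nia.
Qed.
End Constraints.

(** * Greedy selection, standard automorphisms and square roots *)

Section Standard.
Local Open Scope group_scope.
Variable gT : finGroupType.
Notation V := (gT * bool)%type.
Implicit Types (S : {set gT}) (p q : V) (a b : V * V) (Q : {set V * V}) (phi : {perm V}).

(** Each round adds one vertex and at least [n] new gaps, distinct by [gap_injl]; the minimum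
    records that the process stops once 12n^2 gaps are reached. *)
Lemma greedy_set phi (B : {set V}) s n j :
    {in B, forall p, p.2 = s /\ heavy phi p} -> #|B| = (12 * n)%N ->
    (144 * n ^ 2 <= #|gT|)%N ->
  exists2 Y : {set V}, (#|Y| <= j)%N &
    (minn (j * n) (12 * n ^ 2) <= #|constrained (perm_graph phi (B :|: Y))|)%N.
Proof.
move=> BP Bn nr; elim: j => [|j [Y Yj IH]].
  by exists set0; rewrite ?cards0 // mul0n min0n.
set Z := constrained _ in IH.
have [Zn|Zn] := ltnP #|Z| (12 * n ^ 2); last first.
  exists Y; first exact: leqW.
  by apply: leq_trans (geq_minr _ _) Zn.
have [q qn] := greedy_step BP Bn nr Zn.
exists (q |: Y); first by apply: leq_trans (leq_of_leqif (leq_card_setU _ _)) _; rewrite cards1.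
set W := [set p in B | _] in qn.
have sub : Z :|: [set gap p q | p in W] \subset constrained (perm_graph phi (B :|: (q |: Y))).
  rewrite subUset; apply/andP; split.
    by apply: constrainedS; apply: imsetS; apply: setUS; apply: subsetUr.
  apply/subsetP => z /imsetP[p]; rewrite inE => /and3P[pB br _] ->.
  by apply: constrained_graphP => //; rewrite !inE ?pB ?eqxx ?orbT.
apply: leq_trans (subset_leq_card sub).
have /eqP -> : #|Z :|: [set gap p q | p in W]| == (#|Z| + #|W|)%N.
  rewrite -(card_in_imset (f := fun p => gap p q)).
    rewrite (leq_card_setU _ _).2 -setI_eq0; apply/eqP/setP => x; rewrite !inE.
    apply/negP => /andP[xZ /imsetP[p]]; rewrite inE => /and3P[_ _ +] xE.
    by rewrite -xE xZ.
  move=> p p'; rewrite !inE => /and3P[_ /broken_side ? _] /and3P[_ /broken_side ? _].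
  exact: gap_injl.
move: IH qn Zn; do 2 move: #|_|; nia.
Qed.

Definition std_perm s (g : gT) t : {perm V} :=
  pair_perm ((if s then inversion gT else 1) * right_translation g)
            (if t then swap else 1).

Lemma std_permE s g t p :
  std_perm s g t p = ((if s then p.1^-1 else p.1) * g, p.2 (+) t).
Proof.
by rewrite permE /= permM permE; case: s t => [] []; rewrite ?permE /= ?addbT ?addbF.
Qed.

Lemma pair_permM (U W : finType) (x x' : {perm U}) (y y' : {perm W}) :
  pair_perm x y * pair_perm x' y' = pair_perm (x * x') (y * y').
Proof. by apply/permP => -[u w]; rewrite !(permM, permE). Qed.

Lemma pair_perm1 (U W : finType) : pair_perm (1 : {perm U}) (1 : {perm W}) = 1.
Proof. by apply/permP => -[u w]; rewrite permE /= !perm1. Qed.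

Lemma std_perm_expected s g t : std_perm s g t \in expected_aut gT.
Proof.
have -> : std_perm s g t = pair_perm (if s then inversion gT else 1) 1
    * pair_perm (right_translation g) 1 * pair_perm 1 (if t then swap else 1).
  by rewrite !pair_permM !mulg1 mul1g.
rewrite !groupM //.
- by case: s; rewrite ?pair_perm1 ?group1 // mem_gen // !inE eqxx orbT.
- by rewrite mem_gen // in_setU; apply/orP; left; apply/imsetP; exists g.
- by case: t; rewrite ?pair_perm1 ?group1 // mem_gen // !inE eqxx !orbT.
Qed.

Hypothesis abG : abelian [set: gT].

Lemma mulgC_abelian (x y : gT) : x * y = y * x.
Proof. by apply: (centsP abG); rewrite inE. Qed.

Lemma gap_std s g t p q :
  gap (std_perm s g t p) (std_perm s g t q) = if s then (gap p q)^-1 else gap p q.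
Proof.
rewrite !std_permE /gap /=; case: s; rewrite !invMg ?invgK -!mulgA mulKVg //.
exact: mulgC_abelian.
Qed.

(** Standard maps preserve gaps up to inversion and preserve whether two vertices share a side,
    which is all that [forced] sees. Hence an automorphism may be normalised without changing its
    broken pairs. *)
Lemma broken_std phi s g t p q : broken (phi * std_perm s g t) p q = broken phi p q.
Proof.
rewrite /broken /forced /= !permM gap_std; congr (_ && ~~ (_ && _)).
  by rewrite !std_permE /= (inj_eq (@addIb t)).
by rewrite !inE; case: s => //; rewrite eqg_invLR (inj_eq invg_inj) orbC.
Qed.

Lemma std_automorphism S s g t p q : inverse_closed S ->
  double_cover (Cay S) (std_perm s g t p) (std_perm s g t q) = double_cover (Cay S) p q.
Proof.
move=> SI; rewrite !double_coverE gap_std !std_permE /= (inj_eq (@addIb t)).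
by case: s; rewrite ?inverse_closedV.
Qed.

Definition square_roots (c : gT) := [set x : gT | x ^+ 2 == c].

Lemma sqrMg (x y : gT) : (x * y) ^+ 2 = x ^+ 2 * y ^+ 2.
Proof. by rewrite expgMn //; apply: mulgC_abelian. Qed.

(** Squaring is an endomorphism of an abelian group, so its nonempty fibres are cosets of the
    kernel. *)
Lemma card_square_roots x : #|square_roots (x ^+ 2)| = #|square_roots 1|.
Proof.
rewrite -[RHS](card_imset _ (mulIg x)); apply: eq_card => y; apply/idP/imsetP.
  rewrite inE => /eqP yx; exists (y * x^-1); last by rewrite mulgKV.
  by rewrite inE sqrMg expVgn yx mulgV.
by case=> z; rewrite !inE => /eqP z1 ->; rewrite sqrMg z1 mul1g.
Qed.

(** The fibre over y^2 is disjoint from both fibres of the union, and all three have the same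
    size. *)
Lemma card_square_roots_two_thirds (x y z : gT) : y ^+ 2 != x ^+ 2 -> z ^+ 2 != x ^+ 2 ->
  (3 * #|square_roots (x ^+ 2) :|: square_roots ((y * z * x^-1) ^+ 2)| <= 2 * #|gT|)%N.
Proof.
move=> yx zx; set A := _ :|: _.
have : (#|A :|: square_roots (y ^+ 2)| <= #|gT|)%N by apply: max_card.
have /eqP -> : #|A :|: square_roots (y ^+ 2)| == (#|A| + #|square_roots (y ^+ 2)|)%N.
  rewrite (leq_card_setU _ _).2 -setI_eq0; apply/eqP/setP => u; rewrite !inE.
  apply/negP => /andP[/orP[] /eqP -> /eqP e]; first by rewrite e eqxx in yx.
  case/eqP: zx; apply: (mulIg (x ^- 2)); rewrite mulgV.
  by apply: (mulgI (y ^+ 2)); rewrite mulg1 -[RHS]e !sqrMg expVgn mulgA.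
have := leq_of_leqif (leq_card_setU (square_roots (x ^+ 2)) (square_roots ((y * z * x^-1) ^+ 2))).
by rewrite -/A !card_square_roots; lia.
Qed.
Hypothesis expG : (2 < exponent [set: gT])%N.

(** Exponent greater than 2 provides a second nonempty fibre, disjoint from the kernel and of the
    same size. *)
Lemma card_square_roots_half c : (2 * #|square_roots c| <= #|gT|)%N.
Proof.
have le1 : (#|square_roots c| <= #|square_roots 1|)%N.
  have [->|[x]] := set_0Vmem (square_roots c); first by rewrite cards0.
  by rewrite inE => /eqP <-; rewrite card_square_roots.
have [y y2] : exists y : gT, y ^+ 2 != 1.
  case: (pickP (fun y : gT => y ^+ 2 != 1)) => [y y2|all1]; first by exists y.
  have : (exponent [set: gT] %| 2)%N.
    by apply/exponentP => x _; apply/eqP/negbFE/all1.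
  by move=> /dvdn_leq; lia.
have : (#|square_roots 1 :|: square_roots (y ^+ 2)| <= #|gT|)%N by apply: max_card.
have /eqP -> : #|square_roots 1 :|: square_roots (y ^+ 2)| ==
    (#|square_roots 1| + #|square_roots (y ^+ 2)|)%N.
  rewrite (leq_card_setU _ _).2 -setI_eq0; apply/eqP/setP => x; rewrite !inE.
  by apply: contraNF y2 => /andP[/eqP -> /eqP <-].
rewrite card_square_roots; lia.
Qed.

End Standard.

(** * Rigidity of maps with few heavy vertices *)

Section Rigidity.
Local Open Scope group_scope.
Variable gT : finGroupType.
Notation V := (gT * bool)%type.
Implicit Types (S : {set gT}) (p q : V) (a b : V * V) (Q : {set V * V}) (phi psi : {perm V}).

Lemma brokenC phi p q : broken phi p q = broken phi q p.
Proof.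
rewrite /broken /forced /= eq_sym; congr (_ && ~~ (_ && _)); first by rewrite eq_sym.
have gapV (u v : V) : gap u v = (gap v u)^-1 by rewrite /gap invMg invgK.
rewrite !inE (gapV p q) (gapV (phi p)) (inj_eq invg_inj) invgK.
by rewrite eqg_invLR.
Qed.

Hypothesis abG : abelian [set: gT].

(** With p' the image of p, being unbroken means q p'^-1 = (q p^-1)^{+-1}; the sign + gives p' = p
    and the sign - gives q^2 = p p'. *)
Lemma fixed_unbroken psi p q : p.2 != q.2 -> psi q = q -> ~~ broken psi p q ->
  (psi p).2 = p.2 /\ ((psi p).1 = p.1 \/ q.1 ^+ 2 = p.1 * (psi p).1).
Proof.
move=> pq fq; rewrite /broken /forced /= pq negbK /gap fq !inE => /andP[ppq e]; split.
  by move: pq ppq; case: (psi p).2 p.2 q.2 => [] [] [].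
case/orP: e => /eqP; first by move/mulgI/invg_inj; left.
rewrite invMg invgK => e; right.
have : q.1 * (psi p).1^-1 * ((psi p).1 * q.1) = p.1 * q.1^-1 * ((psi p).1 * q.1) by rewrite e.
by rewrite expgS expg1 mulgA mulgKV => ->; rewrite (mulgC_abelian abG (psi p).1) mulgA mulgKV.
Qed.

Lemma card_side s : #|[set p : V | p.2 == s]| = #|gT|.
Proof.
rewrite -cardsT -(card_imset (f := fun g : gT => (g, s))); last by move=> g g' [].
apply: eq_card => -[g t]; rewrite inE /=; apply/eqP/imsetP => [->|[g' _ [_ ->]]] //.
by exists g.
Qed.

(** Inversion recentred at [p]: it keeps both sides and fixes [p]. *)
Definition reflection p := std_perm true (p.1 ^+ 2) false.

Hypothesis expG : (2 < exponent [set: gT])%N.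

(** Each vertex of [T] is fixed by [psi] or by its reflected version. If both versions moved some
    vertex of [T], two light vertices [q] and [q'] of opposite behaviour would force squares on the
    side of [p0] into two fibres, too few for that side. *)
Lemma dominant_sign psi p0 : psi p0 = p0 ->
  let T := [set q | [&& q.2 != p0.2, ~~ heavy psi q & ~~ broken psi p0 q]] in
  {in T, forall q, psi q = q} \/ {in T, forall q, (psi * reflection p0) q = q}.
Proof.
move=> fix0 T; set psi' := psi * reflection p0.
have psi'E q : psi' q = ((psi q).1^-1 * p0.1 ^+ 2, (psi q).2).
  by rewrite permM std_permE addbF.
have TP q : q \in T -> psi q = q \/ psi' q = q.
  rewrite inE brokenC => /and3P[side _ nb].
  have [side' [e|e]] := fixed_unbroken side fix0 nb; [left|right].
    by rewrite [LHS]surjective_pairing side' e -surjective_pairing.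
  by rewrite psi'E e (mulgC_abelian abG q.1) mulKg side' -surjective_pairing.
case: (pickP (fun q => (q \in T) && (psi q != q))) => [q /andP[qT mq]|all1]; last first.
  by left=> v vT; apply/eqP; have := all1 v; rewrite vT => /negbFE.
case: (pickP (fun q => (q \in T) && (psi' q != q))) => [q' /andP[q'T mq']|all1]; last first.
  by right=> v vT; apply/eqP; have := all1 v; rewrite vT => /negbFE.
have [/eqP|fq] := TP _ qT; first by rewrite (negbTE mq).
have [fq'|/eqP] := TP _ q'T; last by rewrite (negbTE mq').
(* If the squares agreed, the reflection would fix [q], and then [psi] would fix [q] as well. *)
have x_q : q.1 ^+ 2 != p0.1 ^+ 2.
  apply: contraNneq mq => e; move/eqP: fq; rewrite psi'E -e => /eqP fq.
  have e1 : (psi q).1^-1 * q.1 ^+ 2 = q.1 by rewrite -[in RHS]fq.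
  have e2 : (psi q).2 = q.2 by rewrite -[in RHS]fq.
  rewrite [psi q]surjective_pairing e2 [X in _ == X]surjective_pairing; apply/eqP; congr pair.
  apply: invg_inj; apply: (mulIg (q.1 ^+ 2)); rewrite e1.
  by rewrite expgS expg1 mulKg.
have x_q' : q'.1 ^+ 2 != p0.1 ^+ 2.
  apply: contraNneq mq' => e; rewrite psi'E fq' -e expgS expg1 mulKg.
  by rewrite -surjective_pairing.
have := card_square_roots_two_thirds abG x_q x_q'.
set A := _ :|: _ => A3.
have [] : ~~ heavy psi q /\ ~~ heavy psi q'.
  by move: qT q'T; rewrite !inE => /and3P[_ ? _] /and3P[_ ? _].
rewrite /heavy -!ltnNge.
have side : q.2 = ~~ p0.2 /\ q'.2 = ~~ p0.2.
  by move: qT q'T; rewrite !inE => /and3P[+ _ _] /and3P[+ _ _]; case: p0.2 q.2 q'.2 => [] [] [].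
have cover : [set p : V | p.2 == p0.2] \subset
    [set p | broken psi q p] :|: [set p | broken psi q' p] :|: [set (u, p0.2) | u in A].
  apply/subsetP => -[u s]; rewrite !inE /= => /eqP ->; set p := (u, p0.2).
  case: (boolP (broken psi q p)) => //= nb; case: (boolP (broken psi q' p)) => //= nb'.
  apply: imset_f; rewrite !inE.
  have pq : p.2 != q.2 by case: side => -> _ /=; case: p0.2.
  have pq' : p.2 != q'.2 by case: side => _ -> /=; case: p0.2.
  rewrite brokenC in nb; rewrite brokenC in nb'.
  have [_ h'] := fixed_unbroken pq' fq' nb'.
  have [] := fixed_unbroken (psi := psi') pq fq; first by rewrite broken_std.
  rewrite psi'E /= => _ h; rewrite /= in h'.
  (* The two mixed alternatives contradict [x_q] and [x_q']. The other two give u^2 = p0^2, or, on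
     multiplying the equations, u^2 = (q q' p0^-1)^2. *)
  case: h' h => [->|e'] [e|e].
  - apply/orP; left; apply/eqP; change (u ^+ 2 = p0.1 ^+ 2).
    by rewrite expgS expg1 -{2}e mulgA mulgV mul1g.
  - by case/eqP: x_q; rewrite e mulgA mulgV mul1g.
  - case/eqP: x_q'; rewrite e' -[X in X * _]e.
    by rewrite (mulgC_abelian abG) mulgA mulgV mul1g.
  - apply/orP; right; apply/eqP; change (u ^+ 2 = (q.1 * q'.1 * p0.1^-1) ^+ 2).
    rewrite !(sqrMg abG) e e' expVgn (mulgC_abelian abG (psi p).1^-1).
    rewrite (mulgC_abelian abG u (psi p).1).
    rewrite -!mulgA mulKg (mulgC_abelian abG u (p0.1 ^- 2)) (mulgA p0.1 p0.1).
    by rewrite -[p0.1 * p0.1]/(p0.1 ^+ 2) mulKVg.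
(* The side has r vertices, but the cover has fewer than r/6 + r/6 + 2r/3. *)
have := leq_trans (subset_leq_card cover) (leq_of_leqif (leq_card_setU _ _)).
have := leq_of_leqif (leq_card_setU [set p | broken psi q p] [set p | broken psi q' p]).
have := leq_imset_card (fun u => (u, p0.2)) A.
rewrite card_side; move: A3; do 6 move: #|_|; lia.
Qed.

(** An unbroken partner of a moved [p] in [F] solves q^2 = p psi(p), which has at most r/2
    solutions; at least 2r/3 - r/2 = r/6 partners are broken. *)
Lemma moved_heavy psi p (F : {set V}) :
    psi p != p -> {in F, forall q, p.2 != q.2 /\ psi q = q} ->
  (2 * #|gT| <= 3 * #|F|)%N -> heavy psi p.
Proof.
move=> mp FP Fbig; set R := square_roots (p.1 * (psi p).1).
have : F \subset [set q | broken psi p q] :|: [set (u, ~~ p.2) | u in R].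
  apply/subsetP => q /FP[pq fq]; rewrite !inE; case: (boolP (broken psi p q)) => //= nb.
  have [side [e|e]] := fixed_unbroken pq fq nb.
    by case/eqP: mp; rewrite [LHS]surjective_pairing side e -surjective_pairing.
  apply/imsetP; exists q.1; first by rewrite inE e.
  rewrite [LHS]surjective_pairing; congr pair.
  by move: pq; case: p.2 q.2 => [] [].
move=> /subset_leq_card/leq_trans/(_ (leq_of_leqif (leq_card_setU _ _))).
have := leq_imset_card (fun u => (u, ~~ p.2)) R.
have := card_square_roots_half abG expG (p.1 * (psi p).1); rewrite -/R /heavy.
by move: Fbig; do 5 move: #|_|; lia.
Qed.

Lemma heavy_std phi s g t p : heavy (phi * std_perm s g t) p = heavy phi p.
Proof.
rewrite /heavy; congr (_ <= 6 * _)%N; apply: eq_card => q.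
by rewrite !inE broken_std.
Qed.

Lemma std_perm_reflect g t p :
  std_perm false g t * reflection p = std_perm true (g^-1 * p.1 ^+ 2) t.
Proof.
apply/permP => -[u s]; rewrite permM !std_permE /= addbF invMg.
by rewrite (mulgC_abelian abG g^-1) -mulgA.
Qed.

(* Most of side [true] is fixed by [dominant_sign], which makes moved vertices
   of side [false] heavy, hence few, and this in turn handles side [true]. *)
Lemma few_heavy phi n : (0 < n)%N -> (144 * n ^ 2 <= #|gT|)%N ->
    (forall s, #|[set p | (p.2 == s) && heavy phi p]| < 12 * n)%N ->
  exists s g t, let psi := phi * std_perm s g t in
    (#|[set p | psi p != p]| <= 24 * n)%N /\ forall p, psi p != p -> heavy psi p.
Proof.
move=> n_gt0 nr few.
have nr72 : (72 * n <= #|gT|)%N by nia.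
have [p0 p0s p0l] : exists2 p0, p0.2 = false & ~~ heavy phi p0.
  case: (pickP (fun p => (p.2 == false) && ~~ heavy phi p)) => [p /andP[/eqP ? ?]|all1].
    by exists p.
  exfalso; have := few false; rewrite ltnNge => /negP[].
  apply: (@leq_trans #|[set p : V | p.2 == false]|); first by rewrite card_side; lia.
  apply: subset_leq_card; apply/subsetP => p; rewrite !inE => ps; rewrite ps /=.
  by have := all1 p; rewrite ps => /negbFE.
(* The translation and swap that bring the image of [p0] back; the swap bit works because [p0] has
   side [false]. *)
pose psi0 := phi * std_perm false ((phi p0).1^-1 * p0.1) (phi p0).2.
have fix0 : psi0 p0 = p0.
  by rewrite permM std_permE mulKVg addbb -p0s -surjective_pairing.
set T := [set q | [&& q.2 != p0.2, ~~ heavy phi q & ~~ broken phi p0 q]].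
(* From the r vertices of side [true], fewer than 12n <= r/6 heavy ones and fewer than r/6 broken
   partners of the light [p0] are removed. *)
have Tbig : (4 * #|gT| <= 6 * #|T|)%N.
  have : [set q : V | q.2 == true] \subset
      T :|: [set q | (q.2 == true) && heavy phi q] :|: [set q | broken phi p0 q].
    apply/subsetP => q; rewrite !inE p0s => /eqP -> /=.
    by case: (heavy phi q) => //=; case: (broken _ _ _).
  move=> /subset_leq_card/leq_trans/(_ (leq_of_leqif (leq_card_setU _ _))).
  have := leq_of_leqif (leq_card_setU T [set q | (q.2 == true) && heavy phi q]).
  move: (few true) p0l nr72; rewrite /heavy -ltnNge card_side; do 5 move: #|_|.
  lia.
have [s [g [t fixT]]] : exists s g t, {in T, forall q, (phi * std_perm s g t) q = q}.
  have TE : T = [set q | [&& q.2 != p0.2, ~~ heavy psi0 q & ~~ broken psi0 p0 q]].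
    by apply/setP => q; rewrite !inE heavy_std broken_std.
  have := dominant_sign fix0; rewrite -TE => -[fixT|fixT].
    by exists false, ((phi p0).1^-1 * p0.1), (phi p0).2.
  exists true, (((phi p0).1^-1 * p0.1)^-1 * p0.1 ^+ 2), (phi p0).2.
  by move=> q qT; rewrite -std_perm_reflect mulgA; apply: fixT.
exists s, g, t => psi; rewrite -/psi in fixT.
have hv0 p : p.2 = false -> psi p != p -> heavy psi p.
  move=> ps mp; apply: (moved_heavy (F := T) mp); last by move: Tbig; do 2 move: #|_|; lia.
  by move=> q qT; rewrite fixT // ps; move: qT; rewrite inE p0s => /andP[]; case: q.2.
have few' s' : (#|[set p | (p.2 == s') && heavy psi p]| < 12 * n)%N.
  apply: leq_ltn_trans (few s'); apply: subset_leq_card; apply/subsetP => p.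
  by rewrite !inE heavy_std.
(* By [hv0] fewer than 12n <= r/6 vertices of side [false] move, so its fixed vertices suffice for
   [moved_heavy]. *)
have hv1 p : p.2 = true -> psi p != p -> heavy psi p.
  move=> ps mp; apply: (moved_heavy (F := [set q | (q.2 == false) && (psi q == q)]) mp).
    by move=> q; rewrite inE ps => /andP[/eqP -> /eqP ->].
  have : [set q : V | q.2 == false] \subset
      [set q | (q.2 == false) && (psi q == q)] :|: [set q | (q.2 == false) && heavy psi q].
    apply/subsetP => q; rewrite !inE => /eqP qs; rewrite qs eqxx /=.
    by case: eqVneq => //= mq; apply: hv0.
  move=> /subset_leq_card/leq_trans/(_ (leq_of_leqif (leq_card_setU _ _))).
  move: (few' false) nr72; rewrite card_side; do 3 move: #|_|; lia.
have hv p : psi p != p -> heavy psi p by case ps : p.2; [apply: hv1 | apply: hv0].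
split=> //.
have : [set p | psi p != p] \subset
    [set p | (p.2 == false) && heavy psi p] :|: [set p | (p.2 == true) && heavy psi p].
  by apply/subsetP => p; rewrite !inE => /hv ->; case: p.2.
move=> /subset_leq_card/leq_trans/(_ (leq_of_leqif (leq_card_setU _ _))).
by move: (few' false) (few' true); do 3 move: #|_|; lia.
Qed.
End Rigidity.

(** * Counting small subsets and unions *)

Section FinsetCounting.

Lemma subset_of_card (T : finType) (A : {set T}) n :
  (n <= #|A|)%N -> exists2 B : {set T}, B \subset A & #|B| = n.
Proof.
move=> nA; exists [set x in take n (enum A)].
  by apply/subsetP => x; rewrite inE => /mem_take; rewrite mem_enum.
rewrite cardsE; have /card_uniqP -> : uniq (take n (enum A)) by rewrite take_uniq ?enum_uniq.
by rewrite size_takel // -cardE.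
Qed.

(** A nonempty set of at most [m] elements is the range of an [m]-tuple, padded by repeating one of
    its elements. *)
Lemma card_small_sets (T : finType) m :
  (#|[set Q : {set T} | (0 < #|Q| <= m)%N]| <= #|T| ^ m)%N.
Proof.
rewrite -card_tuple -cardsT.
apply: leq_trans (leq_imset_card (fun t : m.-tuple T => [set x in tval t]) _).
apply: subset_leq_card; apply/subsetP => Q; rewrite inE => /andP[Q0 Qm].
have /card_gt0P[x0 x0Q] := Q0.
have sz : size (enum Q ++ nseq (m - #|Q|) x0) == m.
  by rewrite size_cat size_nseq -cardE subnKC.
apply/imsetP; exists (Tuple sz); rewrite ?inE //; apply/setP => x; rewrite inE /= mem_cat.
rewrite mem_enum mem_nseq; case: (boolP (x \in Q)) => //= xQ; symmetry.
by apply/negP => /andP[_ /eqP xE]; rewrite xE x0Q in xQ.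
Qed.

Lemma card_bigcup_le (I T : finType) (P : pred I) (A : I -> {set T}) :
  (#|\bigcup_(i | P i) A i| <= \sum_(i | P i) #|A i|)%N.
Proof.
apply: (big_rec2 (fun (X : {set T}) s => #|X| <= s)%N); first by rewrite cards0.
move=> i s X _ Xs; apply: leq_trans (leq_of_leqif (leq_card_setU _ _)) _.
by rewrite leq_add2l.
Qed.

End FinsetCounting.

(** * Extra automorphisms and the union bound *)

Section Automorphisms.
Local Open Scope group_scope.
Variable gT : finGroupType.
Notation V := (gT * bool)%type.
Implicit Types (S : {set gT}) (p q : V) (a b : V * V) (Q : {set V * V}) (phi psi : {perm V}).

Lemma graph_autP (W : finType) (E : rel W) (x : {perm W}) :
  reflect (forall u v, E (x u) (x v) = E u v) (x \in graph_aut E).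
Proof.
rewrite inE; apply: (iffP 'forall_forallP) => h u v; first exact/eqP.
by rewrite h.
Qed.

Lemma pair_permE (U W : finType) (x : {perm U}) (y : {perm W}) (p : U * W) :
  pair_perm x y p = (x p.1, y p.2).
Proof. exact: permE. Qed.

Lemma expected_generators :
  [/\ forall g : gT, pair_perm (right_translation g) 1 = std_perm false g false,
      pair_perm (inversion gT) 1 = std_perm true 1 false
    & pair_perm 1 swap = std_perm false (1 : gT) true].
Proof.
have r1 : right_translation (1 : gT) = 1.
  by apply/permP => x; rewrite permE perm1 mulg1.
by split=> [g||]; rewrite /std_perm ?r1 ?mul1g ?mulg1.
Qed.

Lemma expected_subset (A : {group {perm V}}) :
  (forall s g t, std_perm s g t \in A) -> expected_aut gT \subset A.
Proof.
move=> stdA; rewrite gen_subG; apply/subsetP => x; rewrite !inE.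
case/orP => [/imsetP[g _ ->]|/orP[/eqP->|/eqP->]].
- by have [-> _ _] := expected_generators.
- by have [_ -> _] := expected_generators.
- by have [_ _ ->] := expected_generators.
Qed.

Hypothesis abG : abelian [set: gT].

Lemma expected_sub_aut S : inverse_closed S ->
  expected_aut gT \subset graph_aut (double_cover (Cay S)).
Proof.
move=> SI; apply: expected_subset => s g t; apply/graph_autP => p q.
exact: std_automorphism.
Qed.

Lemma pair_perm_group_set (U W : finType) (A : {group {perm U}}) (B : {group {perm W}}) :
  group_set [set pair_perm a b | a in A, b in B].
Proof.
apply/group_setP; split.
  by apply/imset2P; exists 1 1; rewrite ?group1 ?pair_perm1.
move=> x y /imset2P[a b aA bB ->] /imset2P[c d cA dB ->].
by apply/imset2P; exists (a * c) (b * d); rewrite ?groupM ?pair_permM.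
Qed.

(** Pair permutations form a group containing all standard maps, which gives one inclusion; the
    other holds for every graph. *)
Lemma expected_stable S : inverse_closed S ->
  graph_aut (double_cover (Cay S)) = expected_aut gT -> stable_graph (Cay S).
Proof.
move=> SI autE; rewrite /stable_graph eqEsubset; apply/andP; split.
  rewrite autE; apply: (expected_subset (A := Group (pair_perm_group_set _ _))) => s g t.
  apply/imset2P; econstructor; last reflexivity.
    apply/graph_autP => u v.
    (* Between the sides [false] and [true], adjacency in the double cover is adjacency in the
       Cayley graph. *)
    have := std_automorphism abG s g false (u, false) (v, true) SI.
    by rewrite /double_cover /Defs.direct_product !pair_permE /K2 /= !perm1 !andbT.

  by apply/graph_autP => u v; rewrite /K2; case: t; rewrite ?perm1 ?permE //; case: u v => [] [].
apply/subsetP => _ /imset2P[a b /graph_autP aA /graph_autP bB ->].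
by apply/graph_autP => p q; rewrite /double_cover /Defs.direct_product !pair_permE /= aA bB.
Qed.

(* With [fixing], the partial map [Q] is completed by the identity. *)
Definition extend (fixing : bool) Q : {set V * V} :=
  if fixing then Q :|: [set (x, x) | x in [set x : V | x \notin [set a.1 | a in Q]]]
  else Q.

Lemma compatible_graph S psi (A : {set V}) : inverse_closed S ->
  psi \in graph_aut (double_cover (Cay S)) -> S \in compatible (perm_graph psi A).
Proof.
move=> SI /graph_autP psiA; rewrite !inE SI /=.
apply/forall_inP => _ /imsetP[p _ ->]; apply/forall_inP => _ /imsetP[q _ ->] /=.
by rewrite psiA.
Qed.

Hypothesis expG : (2 < exponent [set: gT])%N.

(** Provides the short certificates for the union bound: a greedy partial map if one side has many
    heavy vertices, and otherwise the list of moved vertices of a normalised automorphism. *)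
Lemma extra_automorphism S phi n : (0 < n)%N -> (144 * n ^ 2 <= #|gT|)%N ->
    inverse_closed S -> phi \in graph_aut (double_cover (Cay S)) ->
    phi \notin expected_aut gT ->
  exists fixing Q, [/\ (0 < #|Q| <= 24 * n)%N, S \in compatible (extend fixing Q)
    & (12 * n ^ 2 <= #|constrained (extend fixing Q)|)%N].
Proof.
move=> n_gt0 nr SI phiA phiN.
case: (pickP (fun s => 12 * n <= #|[set p | (p.2 == s) && heavy phi p]|)%N) => [s many|few].
  have [B /subsetP BP Bn] := subset_of_card many.
  (* 12n rounds of n gaps each give 12n^2, for a total of at most 24n vertices. *)
  have [|Y Yn QY] := greedy_set (phi := phi) (B := B) (s := s) (n := n) (12 * n) _ Bn nr.
    by move=> p /BP; rewrite inE => /andP[/eqP].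
  exists false, (perm_graph phi (B :|: Y)); split.
  - rewrite card_imset; last by move=> p q [].
    apply/andP; split.
      by apply: leq_trans (subset_leq_card (subsetUl _ _)); rewrite Bn; lia.
    by apply: leq_trans (leq_of_leqif (leq_card_setU _ _)) _; rewrite Bn; lia.
  - exact: compatible_graph.
  - by apply: leq_trans QY; rewrite leq_min; lia.
have [|s [g [t]]] := few_heavy abG expG n_gt0 nr (phi := phi).
  by move=> s; have /negbT := few s; rewrite -ltnNge.
set psi := phi * _ => -[mcard mheavy].
have sE : std_perm s g t \in expected_aut gT by apply: std_perm_expected.
have psiA : psi \in graph_aut (double_cover (Cay S)).
  by rewrite groupM // (subsetP (expected_sub_aut SI)).
have [p mp] : exists p, psi p != p.
  case: (pickP (fun p => psi p != p)) => [p mp|fixed]; first by exists p.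
  case/negP: phiN; rewrite -(groupMr _ sE) -/psi (_ : psi = 1) ?group1 //.
  by apply/permP => p; rewrite perm1; apply/eqP/negbFE/fixed.
pose M := [set p | psi p != p].
have gE : extend true (perm_graph psi M) = perm_graph psi setT.
  apply/setP => -[u v]; rewrite /extend inE; apply/orP/imsetP => [[]|[w _ ->]].
  - by case/imsetP => w _ ->; exists w.
  - case/imsetP => w; rewrite inE => wN ->; exists w => //; congr pair.
    apply/eqP; rewrite eq_sym; apply: contraNT wN => mw.
    by apply/imsetP; exists (w, psi w) => //; apply: imset_f; rewrite inE.
  - case: (eqVneq (psi w) w) => [fw|mw].
      right; apply/imsetP; exists w; last by rewrite fw.
      rewrite inE; apply/imsetP => -[_ /imsetP[x xM ->] /= wx].
      by move: xM; rewrite inE -wx fw eqxx.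
    by left; apply: imset_f; rewrite inE.
exists true, (perm_graph psi M); rewrite gE; split.
- rewrite card_imset; last by move=> x y [].
  by rewrite mcard andbT; apply/card_gt0P; exists p; rewrite inE.
- exact: compatible_graph.
(* One moved vertex is heavy and yields at least r/6 >= 24n^2 distinct gaps. *)
have : [set gap p q | q in [set q | broken psi p q]] \subset constrained (perm_graph psi setT).
  apply/subsetP => z /imsetP[q]; rewrite inE => br ->.
  by apply: constrained_graphP; rewrite ?in_setT.
move=> /subset_leq_card; rewrite card_in_imset; last first.
  by move=> q q'; rewrite !inE => /broken_side ? /broken_side ?; apply: gap_inj.
by move: (mheavy p mp) nr; rewrite /heavy; do 3 move: #|_|; lia.
Qed.

(** Union bound: two values of [fixing] and at most ((2r)^2)^(24n) partial maps, each compatible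
    with a fraction of at most 2^(-2n^2) of the sets, as 12n^2 = 6 * 2n^2. *)
Lemma bad_count n : (0 < n)%N -> (144 * n ^ 2 <= #|gT|)%N ->
  (#|[set S in closed_sets gT | graph_aut (double_cover (Cay S)) != expected_aut gT]|
     * 2 ^ (2 * n ^ 2) <= 2 * (2 * #|gT|) ^ (48 * n) * #|closed_sets gT|)%N.
Proof.
move=> n_gt0 nr.
pose I := (bool * {set V * V})%type.
pose P (i : I) := (0 < #|i.2| <= 24 * n)%N &&
  (12 * n ^ 2 <= #|constrained (extend i.1 i.2)|)%N.
set bad := [set S in _ | _].
have cover : bad \subset \bigcup_(i : I | P i) compatible (extend i.1 i.2).
  apply/subsetP => S; rewrite !inE => /andP[SI autN].
  have [phi phiA phiN] : exists2 phi, phi \in graph_aut (double_cover (Cay S))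
      & phi \notin expected_aut gT.
    apply/subsetPn; apply: contra autN => sub.
    by rewrite eqEsubset sub expected_sub_aut.
  have [fx [Q [Qn SQ cQ]]] := extra_automorphism n_gt0 nr SI phiA phiN.
  by apply/bigcupP; exists (fx, Q) => //; rewrite /P Qn.
have := leq_trans (subset_leq_card cover) (card_bigcup_le _ _).
rewrite -(leq_pmul2r (m := 2 ^ (2 * n ^ 2))) ?expn_gt0 // => /leq_trans; apply.
rewrite big_distrl /=.
apply: (@leq_trans (\sum_(i : I | P i) #|closed_sets gT|)).
  apply: leq_sum => i /andP[_ ci]; apply: compatible_count.
  by apply: leq_trans ci; rewrite mulnA.
rewrite sum_nat_const leq_mul2r; apply/orP; right.
have : [set i | P i] \subset setX [set: bool] [set Q : {set V * V} | (0 < #|Q| <= 24 * n)%N].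
  by apply/subsetP => -[fx Q]; rewrite !inE => /andP[].
move=> /subset_leq_card; rewrite cardsX cardsT card_bool cardsE => /leq_trans; apply.
rewrite leq_mul2l /=; apply: leq_trans (card_small_sets _ _) _.
by rewrite !card_prod card_bool mulnn -expnM mulnA (mulnC #|gT|).
Qed.
End Automorphisms.

(** * Real estimates and the choice of n *)

Section Real.
Local Open Scope ring_scope.
Variable R : realType.
Implicit Types (delta t : R).

Lemma powR2_lt1 (x : R) : 2 `^ x < 1 -> x < 0.
Proof.
rewrite !ltNge; apply: contraNN => x0.
by have := ler_powR (ler1n R 2) x0; rewrite powRr0.
Qed.

Lemma powR2_log2 (x : R) : 0 < x -> 2 `^ (log2 x) = x.
Proof.
move=> x0; rewrite /powR pnatr_eq0 /= /log2 divfK ?lnK //.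
by rewrite gt_eqF // ln_gt0 // ltr1n.
Qed.

Lemma log2_ge (m : nat) (x : R) : (2 ^ m)%:R <= x -> m%:R <= log2 x.
Proof.
move=> mx; have ln2 : 0 < ln 2 :> R by rewrite ln_gt0 // ltr1n.
have m0 : 0 < (2 ^ m)%:R :> R by rewrite ltr0n expn_gt0.
rewrite /log2 ler_pdivlMr // mulr_natl -lnXn ?ltr0n // -natrX.
by rewrite ler_ln ?posrE // (lt_le_trans m0).
Qed.

Lemma h_parameters delta (r : nat) : (2 < r)%N -> h delta r < 1 -> exists n : nat,
  [/\ (0 < n)%N, (144 * n ^ 2 <= r)%N &
    1 + (1 + log2 r%:R) * (48 * n)%:R - (2 * n ^ 2)%:R <=
      - (2 / 25 * r%:R `^ delta) + 3 * log2 r%:R + 1 :> R].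
Proof.
move=> r2; rewrite /h.
have r0 : 0 < r%:R :> R by rewrite ltr0n; lia.
have L1 : 1 <= log2 r%:R :> R by apply: (log2_ge (m := 1)); rewrite ler_nat; lia.
have -> : r%:R `^ (2 * delta) = (r%:R `^ delta) ^+ 2 :> R.
  by rewrite mulrC powRrM powR_mulrn ?powR_ge0.
set t := r%:R `^ delta; set L := log2 _ in L1 *.
set X := (X in 2 `^ X + _); set Y := (Y in _ + 2 `^ Y) => h1.
have X0 : X < 0.
  by apply: powR2_lt1; apply: le_lt_trans h1; rewrite lerDl powR_ge0.
have Y0 : Y < 0.
  by apply: powR2_lt1; apply: le_lt_trans h1; rewrite lerDr powR_ge0.
have t50 : 50 < t by move: Y0; rewrite /Y => Y0; lra.
have L4 : 4 <= L.
  apply: (log2_ge (m := 4)); suff : 16 <= r%:R :> R by [].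
  have Q6 : 6 <= (t ^+ 2 + t + 6) * L ^+ 2 by nra.
  by move: X0; rewrite /X => X0; lra.
(* This choice gives t < n <= t + 1. *)
exists (Num.truncn t).+1.
have t0 : 0 <= t by lra.
have /andP[n1 n2] := truncn_itv t0.
set n := (Num.truncn t).+1 in n2 *.
have n3 : n%:R <= t + 1 by rewrite /n -natr1; lra.
split=> //.
  rewrite -(ler_nat R) natrM natrX.
  (* Multiplied by 24, the right side is below r since [X] is negative, and the left side is
     144(t+1)^2 >= 144n^2. *)
  have Q1 : (t + 1) ^+ 2 * 6 <= (t ^+ 2 + t + 6) * L ^+ 2.
    have L12 : 12 <= L ^+ 2 by nra.
    nra.
  have Q2 : n%:R ^+ 2 <= (t + 1) ^+ 2 by rewrite ler_sqr ?nnegrE //; lra.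
  by move: X0; rewrite /X => X0; lra.
(* This makes the entropy term 48n(1 + L) at most 1.6n^2; the remaining 0.4n^2 absorbs 2t/25. *)
have L5 : 1 + L <= t / 30 by move: Y0; rewrite /Y => Y0; lra.
rewrite (natrM _ 48) (natrM _ 2) natrX.
have Q1 : (1 + L) * (48 * n%:R) <= 16 / 10 * (t * n%:R) by nra.
have Q2 : t * n%:R <= n%:R ^+ 2 by nra.
have Q3 : t <= t * n%:R by rewrite ler_peMr // ler1n.
by rewrite /Y; lra.
Qed.

Lemma bad_ratio_bound (bad N r n : nat) :
    (0 < N)%N -> (0 < r)%N ->
    (bad * 2 ^ (2 * n ^ 2) <= 2 * (2 * r) ^ (48 * n) * N)%N ->
  bad%:R / N%:R <= 2 `^ (1 + (1 + log2 r%:R) * (48 * n)%:R - (2 * n ^ 2)%:R) :> R.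
Proof.
move=> N0 r0; rewrite -(ler_nat R) => le.
rewrite ler_pdivrMr ?ltr0n // powRB //; last by rewrite pnatr_eq0 implybT.
rewrite mulrAC ler_pdivlMr ?powR_gt0 // powRD; last by rewrite pnatr_eq0 implybT.
rewrite powRr1 // powRrM powRD; last by rewrite pnatr_eq0 implybT.
rewrite powRr1 // powR2_log2 ?ltr0n // !powR_mulrn ?mulr_ge0 ?ler0n //.
by move: le; rewrite !natrM !natrX natrM.
Qed.

End Real.

(** * From the count of exceptional sets to the proportion *)

Local Open Scope ring_scope.

(** If h >= 1 the bound is at most 0. Otherwise the second summand of [h] bounds the exceptional
    proportion, while the first, through h < 1, ensures 144n^2 <= r. *)
Lemma proportion_ge (R : realType) (gT : finGroupType) (delta : R) (P : pred {set gT}) :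
    abelian [set: gT] -> (2 < exponent [set: gT])%N ->
    (forall S, inverse_closed S ->
      graph_aut (double_cover (Cay S)) = expected_aut gT -> P S) ->
  1 - h delta #|gT| <= proportion R P.
Proof.
move=> abG expG expP.
have N0 : (0 < #|closed_sets gT|)%N.
  by apply/card_gt0P; exists set0; rewrite inE; apply/forall_inP => x; rewrite inE.
have [h1|h1] := leP 1 (h delta #|gT|).
  by apply: (@le_trans _ _ 0); rewrite ?subr_le0 // divr_ge0.
have r2 : (2 < #|gT|)%N.
  apply: leq_trans expG _; rewrite -cardsT; apply: dvdn_leq; first exact: cardG_gt0.
  exact: exponent_dvdn.
have [n [n0 nr nle]] := h_parameters r2 h1.
have := bad_count abG expG n0 nr; set bad := [set S in _ | _] => /bad_ratio_bound.
move=> /(_ R N0 (ltnW (ltnW r2)))  => badN.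
have cov : (#|closed_sets gT| <= #|[set S | inverse_closed S && P S]| + #|bad|)%N.
  apply: leq_trans (leq_of_leqif (leq_card_setU _ _)); apply: subset_leq_card.
  apply/subsetP => S; rewrite !inE => SI; rewrite SI /=.
  by case: eqP => [/(expP _ SI) ->|]; rewrite ?orbT.
have : 2 `^ (1 + (1 + log2 #|gT|%:R) * (48 * n)%:R - (2 * n ^ 2)%:R) <= h delta #|gT|.
  apply: le_trans (_ : _ <= 2 `^ (- (2 / 25 * #|gT|%:R `^ delta) + 3 * log2 #|gT|%:R + 1)) _.
    by apply: ler_powR => //; rewrite ler1n.
  by rewrite lerDr powR_ge0.
move=> /(le_trans badN) badh; rewrite lerBlDl; apply: le_trans (lerD badh (lexx _)).
rewrite /proportion -mulrDl ler_pdivlMr ?ltr0n // mul1r -natrD ler_nat.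
by rewrite addnC.
Qed.

Theorem theorem1p1 (R : realType) (gT : finGroupType) (delta : R)
    (abelianG : abelian [set: gT])
    (exponentG : (2 < exponent [set: gT])%N)
    (delta_gt0 : 0 < delta) (delta_lt_half : delta < 1 / 2) :
  1 - h delta #|gT|
    <= proportion R
         (fun S : {set gT} =>
            graph_aut (double_cover (Cay S)) == expected_aut gT)
  /\ 1 - h delta #|gT|
    <= proportion R (fun S : {set gT} => stable_graph (Cay S)).
Proof.
split; apply: proportion_ge => // S SI autE; first exact/eqP.
exact: expected_stable.
Qed.
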